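(* Let $p$ be a prime, let $n,r,v \in \mathbb{Z}^+$, and for $1 \le j \le r$ let $v_j$ be an integer with $1 \le v_j \le v$. Let $A_1,\ldots,A_n,B_1,\ldots,B_r \subset \mathbb{Z}/p^v\mathbb{Z}$ be nonempty subsets, each having the property that no two distinct elements are congruent modulo $p$. Let $f_1,\ldots,f_r \in (\mathbb{Z}/p^v\mathbb{Z})[t_1,\ldots,t_n]$. Let $$Z = \Big\{x \in \prod_{i=1}^n A_i \;\Big|\; \forall\, 1 \le j \le r,\ f_j(x) \in B_j \pmod{p^{v_j}}\Big\}.$$ Then $Z = \varnothing$ or $$\# Z \ge \mathfrak{m}\Big(\# A_1,\ldots,\# A_n;\ \sum_{i=1}^n \# A_i - \sum_{j=1}^r (p^{v_j}-\# B_j)\deg f_j\Big).$$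
   Context: For $n,a_1,\ldots,a_n \in \mathbb{Z}^+$ and an integer $N \le \sum_{i=1}^n a_i$, put $\mathfrak{m}(a_1,\ldots,a_n;N) = 1$ if $N < n$, and, if $n \le N \le \sum_{i=1}^n a_i$, let $\mathfrak{m}(a_1,\ldots,a_n;N)$ be the minimum of $\prod_{i=1}^n y_i$ over all $(y_1,\ldots,y_n) \in \mathbb{Z}^n$ with $1 \le y_i \le a_i$ for all $i$ and $\sum_{i=1}^n y_i = N$. For a ring $R$, a subset $B \subset R$, an ideal $I$ of $R$ and $x \in R$, ''$x \in B \pmod I$'' means that there is $b \in B$ with $x - b \in I$. Here ''$\pmod{p^{v_j}}$'' refers to the ideal $p^{v_j}(\mathbb{Z}/p^v\mathbb{Z})$ of $\mathbb{Z}/p^v\mathbb{Z}$. $\deg$ denotes total degree; the zero polynomial is assigned degree $0$. *)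

(* Defs.v *)
Set Warnings "-notation-overridden,-ambiguous-paths,-notation-incompatible-prefix".
From mathcomp Require Import all_boot all_order all_algebra.
From mathcomp.multinomials Require Export mpoly.
From mathcomp Require Import zify.

Set Implicit Arguments.
Unset Strict Implicit.
Unset Printing Implicit Defensive.

Import Order.TTheory GRing.Theory Num.Theory.
Local Open Scope ring_scope.

Definition distribution n (a : 'I_n -> nat) (N : int)
    (y : {ffun 'I_n -> 'I_(\max_i a i).+1}) : bool :=
  [forall i, (1 <= y i <= a i)%N] && (\sum_i (y i)%:Z == N).
Arguments distribution {n} a N y.

(* The index set of the minimum is finite because y i <= a i <= \max_i a i.
   The default \prod_i a i bounds every product \prod_i y i from above, so it
   does not affect the minimum; it is the (junk) value when N > \sum_i a i.
   See min_prodP below. *)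
Definition min_prod n (a : 'I_n -> nat) (N : int) : nat :=
  if N < n%:Z then 1%N
  else (\big[minn/(\prod_i a i)]_(y | distribution a N y) \prod_i y i)%N.

Definition principal_ideal (R : finComNzRingType) (d : R) : {set R} :=
  [set d * c | c : R].

Definition in_mod (R : finComNzRingType) (B I : {set R}) (x : R) : bool :=
  [exists b in B, x - b \in I].

Definition distinct_mod (R : finComNzRingType) (I A : {set R}) : Prop :=
  {in A &, forall x y, x != y -> x - y \notin I}.

(* msize is 1 + the total degree for a nonzero polynomial, and 0 for 0. *)
Definition mpoly_deg n (R : comNzRingType) (f : {mpoly R[n]}) : nat :=
  (msize f).-1.

Definition restricted_zeros (p v n r : nat) (w : 'I_r -> nat)
    (A : 'I_n -> {set 'Z_(p ^ v)}) (B : 'I_r -> {set 'Z_(p ^ v)})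
    (f : 'I_r -> {mpoly 'Z_(p ^ v)[n]}) : {set {ffun 'I_n -> 'Z_(p ^ v)}} :=
  [set x in family A |
    [forall j, in_mod (B j) (principal_ideal (p ^ w j)%:R) (f j).@[x]]].

Lemma distribution_exists n (a : 'I_n -> nat) (k : nat) :
  (forall i, (0 < a i)%N) -> (n + k <= \sum_i a i)%N ->
  exists y : 'I_n -> nat,
    (forall i, (1 <= y i <= a i)%N) /\ (\sum_i y i = n + k)%N.
Proof.
move=> a0; elim: k => [|k IH] le.
  exists (fun=> 1%N); split=> [i|]; first by rewrite a0.
  by rewrite sum1_card card_ord addn0.
have [|y [yb ys]] := IH; first by lia.
have [i hi] : exists i, (y i < a i)%N.
  apply/existsP; apply: contraT; rewrite negb_exists => /forallP H.
  have : (\sum_i a i <= \sum_i y i)%N.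
    by apply: leq_sum => i _; rewrite leqNgt.
  by lia.
exists (fun l => if l == i then (y l).+1 else y l); split=> [l|].
  by case: eqP => [->|_ //]; rewrite hi.
rewrite (bigD1 i) //= eqxx.
rewrite (eq_bigr y); last by move=> l /negPf ->.
by move: ys; rewrite (bigD1 i) //=; lia.
Qed.

Lemma min_prodP n (a : 'I_n -> nat) (N : int) :
  (forall i, (0 < a i)%N) -> n%:Z <= N -> N <= \sum_i (a i)%:Z ->
  (exists y : 'I_n -> int,
     [/\ forall i, 1 <= y i <= (a i)%:Z, \sum_i y i = N
       & \prod_i y i = (min_prod a N)%:Z]) /\
  (forall y : 'I_n -> int,
     (forall i, 1 <= y i <= (a i)%:Z) -> \sum_i y i = N ->
     (min_prod a N)%:Z <= \prod_i y i).
Proof.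
move=> a0 nN Na.
have amax i : (a i <= \max_i a i)%N by apply: leq_bigmax.
pose toZ (y : {ffun 'I_n -> 'I_(\max_i a i).+1}) i := (y i)%:Z.
have ofN (y : 'I_n -> nat) : (forall i, (1 <= y i <= a i)%N) ->
    (\sum_i (y i)%:Z = N) ->
    exists2 z, distribution a N z & forall i, z i = y i :> nat.
  move=> yb ys; exists [ffun i => inord (y i)].
    have E i : ([ffun i => inord (y i)] : {ffun 'I_n -> 'I_(\max_i a i).+1}) i
                 = y i :> nat.
      rewrite ffunE inordK // ltnS; case/andP: (yb i) => _ h.
      exact: leq_trans h (amax i).
    apply/andP; split; first by apply/forallP => i; rewrite E.
    by rewrite -ys; apply/eqP; apply: eq_bigr => i _; rewrite E.
  move=> i; rewrite ffunE inordK // ltnS; case/andP: (yb i) => _ h.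
  exact: leq_trans h (amax i).
have mE : min_prod a N =
    (\big[minn/(\prod_i a i)]_(y | distribution a N y) \prod_i y i)%N.
  by rewrite /min_prod ltNge nN.
have lower y : distribution a N y -> (min_prod a N <= \prod_i y i)%N.
  move=> Dy; rewrite mE.
  suff H s : y \in s -> (\big[minn/(\prod_i a i)]_(y <- s | distribution a N y)
                           \prod_i y i <= \prod_i y i)%N.
    by apply: H; rewrite mem_index_enum.
  elim: s => //= z s IH; rewrite inE big_cons => /orP[/eqP <-|ys].
    by rewrite Dy geq_minl.
  case: ifP => _; last exact: IH.
  by rewrite geq_min IH ?orbT.
have attained : exists2 y, distribution a N y
    & min_prod a N = (\prod_i y i)%N.
  have [k Nk] : exists k : nat, N = (n + k)%N%:Z.
    by exists (absz (N - n%:Z)); lia.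
  have le : (n + k <= \sum_i a i)%N.
    rewrite -lez_nat -Nk; apply: le_trans Na _.
    by rewrite -natz natr_sum; under [leRHS]eq_bigr do rewrite natz.
  have [y0 [yb ys]] := distribution_exists a0 le.
  have [|z Dz zE] := ofN y0 yb.
    by rewrite Nk -ys -natz natr_sum; apply: eq_bigr => i _; rewrite natz.
  have Pa t : distribution a N t -> (\prod_i t i <= \prod_i a i)%N.
    by case/andP=> /forallP h _; apply: leq_prod => i _; case/andP: (h i).
  pose K (u : nat) := (exists2 y, distribution a N y & u = (\prod_i y i)%N) \/
    u = (\prod_i a i)%N.
  have [//|E] : K (min_prod a N).
    rewrite mE; apply: (big_ind K) => [|u1 u2 H1 H2|t Dt]; first by right.
      by rewrite /minn; case: ifP.
    by left; exists t.
  exists z => //; apply/eqP; rewrite eqn_leq lower //= E.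
  exact: Pa.
have prodZ (t : 'I_n -> nat) : \prod_i (t i)%:Z = (\prod_i t i)%N%:Z.
  by rewrite -natz natr_prod; apply: eq_bigr => i _; rewrite natz.
split.
  have [y Dy ->] := attained; exists (toZ y); case/andP: Dy => /forallP h /eqP s.
  by split=> [i| |]; [have := h i; rewrite /toZ; lia | | rewrite -prodZ].
move=> y yb ys.
have yE i : y i = (absz (y i))%:Z by rewrite gez0_abs //; have := yb i; lia.
have [||z Dz zE] := ofN (fun i => absz (y i)).
- by move=> i; have := yb i; have := yE i; lia.
- by rewrite -ys; apply: eq_bigr => i _; rewrite -yE.
rewrite (eq_bigr (fun i => (absz (y i))%:Z)); last by move=> i _; exact: yE.
rewrite prodZ lez_nat; apply: leq_trans (lower z Dz) _.
by apply: leq_prod => i _; rewrite zE.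
Qed.

(* Main.v *)
Require Import Defs.
From mathcomp Require Import all_boot all_order all_algebra.
From mathcomp.multinomials Require Import mpoly.
From mathcomp Require Import zify.

Set Implicit Arguments.
Unset Strict Implicit.
Unset Printing Implicit Defensive.

Import Order.TTheory GRing.Theory Num.Theory.
Local Open Scope ring_scope.

(** Lift everything to the integers.  For [q = p ^ w] and [B] a set of residues
    mod [q], distinct mod [p], let [g_B(y)] be the product of [y - c] over the
    residues [c] mod [q] outside [B].  Its degree is [q - #B] and, with [e] the
    [p]-adic valuation of [(q - 1)!], [p ^ e] always divides [g_B(y)], whereas
    [p ^ e.+1] does so exactly when [y] is not in [B] mod [q].  Hence the product
    of the [g_{B_j}(f_j)], read modulo [p] to the power [1 + sum_j e_j], is
    nonzero exactly on [Z].  The Alon-Furedi theorem, valid over a commutative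
    ring when the differences of distinct points of each [A_i] are units, bounds
    from below the number of nonzeros of this polynomial. *)

(** * The Alon-Furedi theorem *)

Section AlonFuredi.
Variables (T : eqType) (R : comUnitRingType) (iota : T -> R).
Implicit Types (A : seq T) (As : seq (seq T)) (F : seq T -> R).

(** Points are lists over [T] rather than [R]: coordinates enter polynomials only through [iota]. *)
Fixpoint grid As : seq (seq T) :=
  if As is A :: As' then flatten [seq [seq a :: x | a <- A] | x <- grid As']
  else [:: [::]].

Lemma grid_cons A As a x : (a :: x \in grid (A :: As)) = (a \in A) && (x \in grid As).
Proof.
apply/flatten_mapP/andP => /= [[y yG /mapP[b bA [-> ->]]]|[aA xG]] //.
by exists x => //; apply: map_f.
Qed.

Lemma grid_nil A As : ([::] \in grid (A :: As)) = false.
Proof. by apply/negbTE/flatten_mapP => /= -[y _ /mapP[]]. Qed.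

Lemma mem_grid As x :
  (x \in grid As) = (size x == size As) && all2 (fun a A => a \in A) x As.
Proof.
elim: As x => [|A As IH] [|a x]; rewrite ?grid_nil ?grid_cons ?inE //=.
by rewrite IH eqSS andbCA.
Qed.

Lemma grid_uniq As : all uniq As -> uniq (grid As).
Proof.
elim: As => //= A As IH /andP[uA /IH uG].
elim: (grid As) uG => //= x G IHG /andP[xG uG].
rewrite cat_uniq map_inj_uniq ?uA ?IHG ?andbT //=; last by move=> ? ? [].
apply/hasPn => _ /flatten_mapP[y yG /mapP[b _ ->]].
by apply/mapP => -[c _ [_ E]]; rewrite -E yG in xG.
Qed.

(* [F] agrees on the grid [As] with a polynomial of degree at most [d] whose
   degree in the i-th variable is less than the size of the i-th set; the
   variables are split off one at a time. *)
Fixpoint reduced_poly As d F : Prop :=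
  if As is A :: As' then exists g : nat -> seq T -> R,
    [/\ forall i, (i <= d)%N -> reduced_poly As' (d - i)%N (g i),
        forall i x, (d < i)%N -> g i x = 0
      & forall a x, a \in A -> F (a :: x) = (\poly_(i < size A) g i x).[iota a]]
  else True.

Lemma reduced_poly0 As d : reduced_poly As d (fun=> 0).
Proof.
elim: As d => //= A As IH d; exists (fun _ _ => 0); split=> // a x _.
rewrite (_ : \poly_(_ < _) _ = 0) ?horner0 //.
by apply/polyP => i; rewrite coef_poly coef0 if_same.
Qed.

Lemma reduced_poly_ext As d F F' : F =1 F' -> reduced_poly As d F -> reduced_poly As d F'.
Proof.
by case: As => //= A As E [g [g1 g2 g3]]; exists g; split=> // a x aA; rewrite -E g3.
Qed.

Lemma reduced_polyD As d F F' :
  reduced_poly As d F -> reduced_poly As d F' -> reduced_poly As d (fun x => F x + F' x).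
Proof.
elim: As d F F' => //= A As IH d F F' [g [g1 g2 g3]] [h [h1 h2 h3]].
exists (fun i x => g i x + h i x); split=> [i id|i x di|a x aA].
- by apply: IH; [exact: g1|exact: h1].
- by rewrite g2 ?h2 ?addr0.
- rewrite g3 ?h3 // -hornerD; congr _.[_]; apply/polyP => i.
  by rewrite coefD !coef_poly; case: ifP; rewrite ?addr0.
Qed.

Lemma reduced_polyZ As d F c : reduced_poly As d F -> reduced_poly As d (fun x => c * F x).
Proof.
elim: As d F => //= A As IH d F [g [g1 g2 g3]].
exists (fun i x => c * g i x); split=> [i id|i x di|a x aA].
- exact/IH/g1.
- by rewrite g2 ?mulr0.
- rewrite g3 // -hornerZ; congr _.[_]; apply/polyP => i.
  by rewrite coefZ !coef_poly; case: ifP; rewrite ?mulr0.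
Qed.

Lemma reduced_polyS As d d' F : (d <= d')%N -> reduced_poly As d F -> reduced_poly As d' F.
Proof.
elim: As d d' F => //= A As IH d d' F dd' [g [g1 g2 g3]].
exists g; split=> // [i id'|i x d'i]; last by rewrite g2 ?(leq_ltn_trans dd').
have [id|di] := leqP i d; first by apply: IH (g1 i id); rewrite leq_sub2r.
by apply: reduced_poly_ext (reduced_poly0 _ _) => x; rewrite g2.
Qed.

(** Dividing ['X^k] by the monic polynomial vanishing on [A] leaves a remainder of degree below
    [size A] and at most [k], with the same values on [A]; the total degree therefore does not
    grow. *)
Lemma reduced_poly_monomial As (m : 'I_(size As) -> nat) (x0 : T) :
  reduced_poly As (\sum_i m i)%N (fun x => \prod_(i < size As) iota (nth x0 x i) ^+ m i).
Proof.
elim: As m => //= A As IH m.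
pose phi : {poly R} := \prod_(a <- A) ('X - (iota a)%:P).
have phi_monic : phi \is monic by apply: monic_prod_XsubC.
have size_phi : size phi = (size A).+1 by rewrite size_prod_XsubC.
pose k := m ord0; pose c := Pdiv.CommonRing.rmodp 'X^k phi.
have size_c : (size c <= size A)%N.
  by rewrite -ltnS -size_phi Pdiv.CommonRing.ltn_rmodp monic_neq0.
(* Either [k < size A], and the remainder is ['X^k] itself, or [size c <= size A <= k]. *)
have c0 i : (k < i)%N -> c`_i = 0.
  move=> ki; rewrite nth_default //; have [kA|Ak] := ltnP k (size A).
    by rewrite /c Pdiv.CommonRing.rmodp_small size_polyXn ?size_phi.
  by apply: leq_trans size_c (leq_trans Ak (ltnW ki)).
pose h x := \prod_(i < size As) iota (nth x0 x i) ^+ m (lift ord0 i).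
exists (fun i x => c`_i * h x); split=> [i id|i x di|a x aA].
- have [ik|ki] := leqP i k.
    apply: reduced_polyZ; apply: reduced_polyS (IH (fun i => m (lift ord0 i))).
    by rewrite big_ord_recl -/k -addnBAC // leq_addl.
  by apply: reduced_poly_ext (reduced_poly0 _ _) => x; rewrite c0 ?mul0r.
- by rewrite c0 ?mul0r // (leq_ltn_trans _ di) // big_ord_recl leq_addr.
- rewrite big_ord_recl /= -/k -/(h x).
  have -> : \poly_(i < size A) (c`_i * h x) = h x *: c.
    apply/polyP => i; rewrite coefZ coef_poly mulrC; case: ltnP => // Ai.
    by rewrite nth_default ?mulr0 ?(leq_trans size_c).
  rewrite hornerZ mulrC; congr (_ * _).
  have phia : phi.[iota a] = 0.
    apply/eqP; rewrite horner_prod (big_rem a) //=.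
    by rewrite hornerXsubC subrr mul0r.
  have := congr1 (fun q => q.[iota a]) (Pdiv.RingMonic.rdivp_eq phi_monic 'X^k).
  by rewrite hornerD hornerM phia mulr0 add0r hornerXn.
Qed.

Lemma reduced_poly_meval n (f : {mpoly R[n]}) d As x0 :
  size As = n -> (msize f <= d.+1)%N ->
  reduced_poly As d (fun x => f.@[fun i : 'I_n => iota (nth x0 x i)]).
Proof.
move=> sA; case: _ / sA f => f fd.
apply: reduced_poly_ext (fun x => esym (mevalE _ _)) _.
(* The induction runs over a list of monomials contained in the support, which keeps the degree
   bound on each of them. *)
have : {subset msupp f <= msupp f} by [].
elim: {1 3}(msupp f) => [|m s IH] ms.
  by apply: reduced_poly_ext (reduced_poly0 _ _) => x; rewrite big_nil.
apply: reduced_poly_ext (fun x => esym (big_cons _ _ _ _ _ _)) _.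
apply: reduced_polyD; last by apply: IH => t ts; apply: ms; rewrite inE ts orbT.
apply: reduced_polyZ; apply: reduced_polyS (reduced_poly_monomial _ _).
rewrite -mdegE -ltnS (leq_trans _ fd) // msize_mdeg_lt // ms //.
exact: mem_head.
Qed.

(** Pairwise invertible differences restore the usual bound over a commutative ring: at most [d] of
    the points are roots. *)
Lemma count_nonroots (p : {poly R}) A d :
  uniq_roots (map iota A) -> p != 0 -> (size p <= d.+1)%N ->
  (size A - d <= count (fun a => p.[iota a] != 0%R) A)%N.
Proof.
move=> uA p0 pd.
rewrite leq_subLR -(count_predC (fun a => root p (iota a))).
rewrite leq_add2r -size_filter -(size_map iota) -ltnS (leq_trans _ pd) //.
apply: max_ring_poly_roots p0 _ _.
  by apply/allP => _ /mapP[a + ->]; rewrite mem_filter => /andP[].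
elim: A uA => //= a A IH /andP[aA /IH uA]; case: ifP => //= _; rewrite uA andbT.
apply/allP => _ /mapP[b + ->]; rewrite mem_filter => /andP[_ bA].
by apply: (allP aA); apply: map_f.
Qed.

(* Among the coefficients in the first variable, the one of largest index [i]
   that does not vanish on the remaining grid gives, by induction, many points
   of that grid over each of which at most [i] values are roots. *)
Theorem alon_furedi As d F :
  all (fun A => uniq_roots (map iota A)) As -> reduced_poly As d F ->
  has (fun x => F x != 0) (grid As) ->
  exists ys : seq nat,
    [/\ all2 (fun y A => 0 < y <= size A)%N ys As,
        (sumn (map size As) <= sumn ys + d)%N
      & (\prod_(y <- ys) y <= count (fun x => F x != 0%R) (grid As))%N].
Proof.
elim: As d F => [|A As IH] d F /=.
  move=> _ _; rewrite orbF => F0; exists [::]; split=> //.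
  by rewrite big_nil F0.
case/andP=> uA uAs [g [g1 g2 g3]] /hasP[x0 x0G Fx0].
pose nz i := (i < size A)%N && has (fun x => g i x != 0) (grid As).
have nz_ex : exists i, nz i.
  case: x0 => [|a x] in x0G Fx0; first by rewrite grid_nil in x0G.
  rewrite grid_cons in x0G; case/andP: x0G => aA xG; rewrite g3 // in Fx0.
  pose q := \poly_(i < size A) g i x.
  have q0 : q != 0 by apply: contraNneq Fx0 => q0; rewrite -/q q0 horner0.
  exists (size q).-1; apply/andP; split.
    apply: leq_trans (size_poly (size A) (fun i => g i x)).
    by rewrite prednK ?size_poly_gt0.
  apply/hasP; exists x => //; move: q0; rewrite -lead_coef_eq0 lead_coefE.
  by rewrite coef_poly; case: ifP; rewrite ?eqxx.
have nz_le i : nz i -> (i <= size A)%N by case/andP=> /ltnW.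
have [i /andP[iA gi] i_max] := ex_maxnP nz_ex nz_le.
have id : (i <= d)%N.
  rewrite leqNgt; apply/negP => di; case/hasP: gi => x _.
  by rewrite g2 ?eqxx.
have [ys [ysA sum_ys prod_ys]] := IH _ _ uAs (g1 i id) gi.
exists ((size A - i)%N :: ys); split=> /=.
- by rewrite subn_gt0 iA leq_subr.
- by lia.
rewrite big_cons; apply: leq_trans (leq_mul (leqnn _) prod_ys) _.
rewrite count_flatten -map_comp sumnE big_map -sum1_count big_distrr /=.
rewrite big_mkcond !big_seq leq_sum // => x xG; rewrite count_map.
case: ifP => // gix; rewrite muln1.
pose q := \poly_(j < size A) g j x.
rewrite (@eq_in_count _ _ (fun a => q.[iota a] != 0)) => [|a aA /=]; last by rewrite g3.
apply: count_nonroots => //.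
  apply: contraNneq gix => q0; have := coef_poly (size A) (fun j => g j x) i.
  by rewrite -/q q0 coef0 iA => <-.
apply/leq_sizeP => j ij; rewrite coef_poly; case: ifP => // jA.
apply/eqP; apply: contraLR ij => gj; rewrite -leqNgt; apply: i_max.
by rewrite /nz jA; apply/hasP; exists x.
Qed.
End AlonFuredi.

(** * Comparing minimal products and degrees of products *)

Lemma sum_intz n (a : 'I_n -> nat) : \sum_i (a i)%:Z = (\sum_i a i)%N%:Z.
Proof. by rewrite -natz natr_sum; apply: eq_bigr => i _; rewrite natz. Qed.

(** Lowering [y] to a tuple [z] with sum exactly [N] does not increase the product, and [z] competes
    in the minimum. For [N < n] the value is 1. *)
Lemma min_prod_le_prod n (a y : 'I_n -> nat) (N : int) :
  (forall i, (1 <= y i <= a i)%N) -> N <= \sum_i (y i)%:Z ->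
  (min_prod a N <= \prod_i y i)%N.
Proof.
move=> ya Ny; have y0 i : (0 < y i)%N by case/andP: (ya i).
have [Nn|nN] := ltP N n%:Z.
  by rewrite /min_prod Nn prodn_gt0.
have [k Nk] : exists k : nat, N = (n + k)%N%:Z.
  by exists (absz (N - n%:Z)); lia.
have [|z [zy zN]] := @distribution_exists n y k y0.
  by rewrite -lez_nat -Nk -sum_intz.
apply: leq_trans (_ : \prod_i z i <= _)%N; last first.
  by apply: leq_prod => i _; case/andP: (zy i).
have [|//||_ H] := @min_prodP n a N.
- by move=> i; case/andP: (ya i) => /leq_trans H /H.
- apply: le_trans Ny _; rewrite !sum_intz lez_nat; apply: leq_sum => i _.
  by case/andP: (ya i).
rewrite -lez_nat -[leRHS]natz natr_prod.
rewrite (eq_bigr (fun i => (z i)%:Z)); last by move=> i _; rewrite natz.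
apply: H; last by rewrite sum_intz zN.
move=> i; case/andP: (zy i) => z1 zy1; case/andP: (ya i) => _ ya1.
by rewrite !lez_nat z1 (leq_trans zy1).
Qed.

Lemma msize_prod_le n (R : comNzRingType) (I : Type) (s : seq I) (P : pred I)
    (f : I -> {mpoly R[n]}) (d : I -> nat) :
  (forall i, P i -> (msize (f i) <= (d i).+1)%N) ->
  (msize (\prod_(i <- s | P i) f i)%R <= (\sum_(i <- s | P i) d i).+1)%N.
Proof.
move=> fd; apply: (big_ind2 (fun (g : {mpoly R[n]}) k => msize g <= k.+1)%N) => //.
  by rewrite msize1.
move=> g k h l gk hl; rewrite msizeE; apply/bigmax_leqP_seq => m mgh _.
have /allpairsP[[m1 m2] /= [m1g m2h ->]] := msuppM_le mgh.
have m1k := leq_trans (msize_mdeg_lt m1g) gk.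
have m2l := leq_trans (msize_mdeg_lt m2h) hl.
by rewrite mdegD ltnS leq_add.
Qed.

(** * Separating residues by valuation *)

Lemma Zp_int_eq0 q (z : int) : (1 < q)%N -> (z%:~R == 0 :> 'Z_q) = (q %| `|z|)%N.
Proof.
move=> q1; have H (k : nat) : (k%:R == 0 :> 'Z_q) = (q %| k)%N.
  by rewrite -val_eqE /= val_Zp_nat.
by case: z => k; rewrite ?NegzE ?rmorphN ?oppr_eq0 /= ?abszN /= -H.
Qed.

Lemma Zp_int_unit q (z : int) :
  (1 < q)%N -> ((z%:~R : 'Z_q) \is a GRing.unit) = coprime q `|z|.
Proof.
move=> q1; case: z => k; rewrite ?NegzE ?rmorphN ?unitrN /= ?abszN -?unitZpE //.
Qed.

Section Separation.
Variables (p w : nat).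
Hypotheses (p_prime : prime p) (w_gt0 : (0 < w)%N).
Local Notation q := (p ^ w)%N.
Local Notation L z := (logn p `|z%R|%N).

Let q_gt1 : (1 < q)%N.
Proof. by rewrite -(exp1n w) ltn_exp2r // prime_gt1. Qed.

(** The [p]-adic valuation of [(q - 1)!], kept as a sum over residues so that it can be
    reindexed. *)
Definition cofactor_valuation : nat := (\sum_(c : 'Z_q | c != 0%R) logn p c)%N.

Lemma Zp_intB_eq0 (y : int) (c : 'Z_q) :
  (q %| `|(y - c%:Z)%R|)%N = (c == y%:~R).
Proof.
by rewrite -Zp_int_eq0 // intrB subr_eq0 eq_sym -[c%:Z%:~R]/(c%:R : 'Z_q) natr_Zp.
Qed.

(** For [k <= w], divisibility by [p ^ k] depends only on the residue modulo [q]; a nonzero residue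
    has valuation below [w], so an integer and its representative share their valuation. *)
Lemma logn_intB (y : int) (c : 'Z_q) :
  c != y%:~R -> L (y - c%:Z) = logn p (y%:~R - c : 'Z_q)%R.
Proof.
rewrite -Zp_intB_eq0; set z := y - _ => zq.
have -> : y%:~R - c = z%:~R :> 'Z_q.
  by rewrite intrB -[c%:Z%:~R]/(c%:R : 'Z_q) natr_Zp.
set u : 'Z_q := z%:~R.
have u0 : (0 < u)%N by rewrite lt0n (_ : (_ == _ :> nat) = (u == 0)) // Zp_int_eq0.
have z0 : (0 < `|z|)%N by rewrite lt0n; apply: contraNneq zq => ->.
have [t zE] : exists t : int, z = u%:Z + t * q%:Z.
  have /dvdzP[t E] : (q%:Z %| z - u%:Z)%Z.
    rewrite dvdzE -Zp_int_eq0 // intrB -[u%:Z%:~R]/(u%:R : 'Z_q) natr_Zp.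
    by rewrite subrr.
  by exists t; rewrite -E addrC subrK.
have key k : (k <= w)%N -> (p ^ k %| `|z|)%N = (p ^ k %| u)%N.
  move=> kw; have dt : ((p ^ k)%N%:Z %| t * q%:Z)%Z.
    by apply/dvdz_mull; rewrite dvdzE dvdn_exp2l.
  rewrite -[LHS]/((p ^ k)%N%:Z %| z)%Z -[RHS]/((p ^ k)%N%:Z %| u%:Z)%Z.
  by rewrite zE rpredDr.
have lt x : (0 < x)%N -> ~~ (q %| x)%N -> (logn p x < w)%N.
  by move=> x0; rewrite pfactor_dvdn // -ltnNge.
have ltz := lt _ z0 zq.
have ltu : (logn p u < w)%N.
  by apply: lt => //; rewrite -key.
apply/eqP; rewrite eqn_leq; apply/andP; split; rewrite -pfactor_dvdn //.
  by rewrite -key ?(ltnW ltz) // pfactor_dvdnn.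
by rewrite key ?(ltnW ltu) // pfactor_dvdnn.
Qed.

(** The reflection [c -> y - c] exchanges the residues other than [y] with the nonzero ones. *)
Lemma sum_logn_intB (y : int) :
  (\sum_(c : 'Z_q | c != y%:~R) L (y - c%:Z))%N = cofactor_valuation.
Proof.
rewrite /cofactor_valuation (reindex_inj (inv_inj (subKr (y%:~R : 'Z_q)))).
have E (c : 'Z_q) : (y%:~R - c != y%:~R) = (c != 0).
  by rewrite -subr_eq0 addrAC subrr add0r oppr_eq0.
apply: eq_big => [c|c yc]; first exact: E.
by rewrite logn_intB // subKr.
Qed.

Variable B : {set 'Z_q}.
Hypothesis B_distinct :
  {in B &, forall b c : 'Z_q, b != c -> ~~ (p %| `|(b%:Z - c%:Z)%R|)%N}.

(** Nonvanishing is carried along because [logn] is additive on nonzero factors only. *)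
Lemma logn_prod_neq (y : int) (P : pred 'Z_q) :
  L (\prod_(c : 'Z_q | P c && (c != y%:~R)) (y - c%:Z)) =
  (\sum_(c : 'Z_q | P c && (c != y%:~R)) L (y - c%:Z))%N /\
  (0 < `|(\prod_(c : 'Z_q | P c && (c != y%:~R)) (y - c%:Z))%R|)%N.
Proof.
apply: (big_ind2 (fun (z : int) k => L z = k /\ (0 < `|z|)%N)) => //.
- by rewrite logn1.
- by move=> z1 k1 z2 k2 [<- z10] [<- z20]; rewrite abszM muln_gt0 z10 z20 lognM.
- move=> c /andP[_]; rewrite -Zp_intB_eq0 => zq; split=> //.
  by rewrite lt0n; apply: contraNneq zq => ->.
Qed.

(** At most one [b] in [B] is congruent to [y] modulo [p], and only its factor can have positive
    valuation, at most [w - 1] unless [q] divides it. If [y] lies in [B], this [b] is the excluded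
    index. *)
Lemma sum_logn_distinct (y : int) :
  (\sum_(c in B | c != y%:~R) L (y - c%:Z) <= (y%:~R \notin B) * w.-1)%N.
Proof.
have L0 (c : 'Z_q) : ~~ (p %| `|(y - c%:Z)%R|)%N -> L (y - c%:Z) = 0%N.
  move=> H; apply/eqP; rewrite -leqn0 -ltnS ltnNge; apply: contra H => H.
  by apply: dvdn_trans (pfactor_dvdnn p _); rewrite dvdn_exp.
have congr_uniq (b c : 'Z_q) : b \in B -> c \in B -> 
    (p %| `|(y - b%:Z)%R|)%N -> (p %| `|(y - c%:Z)%R|)%N -> b = c.
  move=> bB cB pb pc; apply/eqP; apply: contraT => /(B_distinct bB cB).
  rewrite -[(p %| _)%N]/((p%:Z %| (b%:Z - c%:Z))%Z).
  rewrite (_ : b%:Z - c%:Z = (y - c%:Z) - (y - b%:Z)); last by lia.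
  by rewrite rpredB.
have [b /andP[bB pb]|none] := pickP [pred c in B | (p %| `|(y - c%:Z)%R|)%N]; last first.
  rewrite big1 // => c /andP[cB _]; apply: L0.
  by have := none c; rewrite /= cB /= => ->.
have others (c : 'Z_q) : c \in B -> c != b -> L (y - c%:Z) = 0%N.
  move=> cB cb; apply: L0; apply: contra cb => pc; apply/eqP.
  exact: congr_uniq.
have [yb|yb] := eqVneq b y%:~R.
  rewrite big1 // => c /andP[cB]; rewrite -yb; exact: others.
have -> : y%:~R \notin B.
  apply: contra yb => yB; apply/eqP; apply: congr_uniq => //.
  apply: dvdn_trans (_ : q %| _)%N; first exact: dvdn_exp.
  by rewrite Zp_intB_eq0.
rewrite (bigD1 b) ?bB //= big1 ?addn0 ?mul1n; last first.
  by move=> c /andP[/andP[cB _]]; apply: others.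
rewrite -ltnS prednK //; move: yb; rewrite -Zp_intB_eq0 => yq.
rewrite ltnNge -pfactor_dvdn // lt0n; apply: contraNneq yq => ->.
by rewrite dvdn0.
Qed.

(* The factors indexed by [c != y] have total valuation [cofactor_valuation]
   independently of [y]; removing the indices in [B] removes valuation at most
   [w - 1], and none if [y \in B], whereas the factor [c = y] contributes at
   least [w]. *)
Lemma dvdn_prod_notin (y : int) :
  let g := `|(\prod_(c : 'Z_q | c \notin B) (y - c%:Z))%R|%N in
  (p ^ cofactor_valuation %| g)%N /\
  (p ^ cofactor_valuation.+1 %| g)%N = (y%:~R \notin B).
Proof.
move=> g.
have sumE : (\sum_(c in B | c != y%:~R) L (y - c%:Z) +
    \sum_(c | (c \notin B) && (c != y%:~R)) L (y - c%:Z) = cofactor_valuation)%N.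
  rewrite -(sum_logn_intB y) [RHS](bigID (mem B)) /=.
  by congr (_ + _)%N; apply: eq_bigl => c; rewrite andbC.
have dist := sum_logn_distinct y.
have [LE g0] := logn_prod_neq y [pred c | c \notin B].
set g' := \prod_(c | _) _ in LE g0; rewrite /= in LE.
rewrite -LE in sumE; move: sumE dist; set S := (\sum_(_ in B | _) _)%N => sumE dist.
have [yB|yB] := boolP (y%:~R \in B); rewrite yB /= ?mul0n ?mul1n in dist *.
  have -> : g = `|g'|%N.
    congr `|_|%N; apply: eq_bigl => c /=; case: eqP => [->|_]; rewrite ?andbT //.
    by rewrite yB.
  by rewrite !pfactor_dvdn //; lia.
suff gd : (p ^ cofactor_valuation.+1 %| g)%N.
  by split; [exact: dvdn_trans (dvdn_exp2l _ (leqnSn _)) gd | rewrite gd].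
have -> : g = (`|(y - (y%:~R : 'Z_q)%:Z)%R| * `|g'|)%N.
  by rewrite /g (bigD1 y%:~R) //= abszM.
apply: dvdn_trans (_ : p ^ (w + logn p `|g'|) %| _)%N.
  by apply: dvdn_exp2l; lia.
by rewrite expnD dvdn_mul ?pfactor_dvdnn // Zp_intB_eq0.
Qed.

End Separation.

(** * Reduction and lifting of the data *)

(** After cancelling [p ^ e i] from each factor, a single further [p] is required, and a prime
    dividing a product divides one of its factors. *)
Lemma dvdn_prod_pfactor p (I : finType) (g e : I -> nat) :
  prime p -> (forall i, (p ^ e i %| g i)%N) ->
  (p ^ (\sum_i e i).+1 %| \prod_i g i)%N = [exists i, (p ^ (e i).+1 %| g i)%N].
Proof.
move=> p_prime eg.
have pe0 i : (0 < p ^ e i)%N by rewrite expn_gt0 prime_gt0.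
have gE i : g i = (p ^ e i * (g i %/ p ^ e i))%N by rewrite mulnC divnK.
rewrite (eq_bigr _ (fun i _ => gE i)) big_split /= expnSr expn_sum.
rewrite dvdn_pmul2l ?prodn_gt0 // Euclid_dvd_prod //.
rewrite big_orE; apply: eq_existsb => i /=.
by rewrite [in RHS]gE expnSr dvdn_pmul2l.
Qed.

Lemma mem_principal_ideal q k (z : int) : (1 < q)%N -> (k %| q)%N ->
  (z%:~R \in principal_ideal (k%:R : 'Z_q)) = (k %| `|z|)%N.
Proof.
move=> q1 kq; apply/imsetP/idP => [[c _ zE]|].
  have : (q %| `|(z - k%:Z * (c : nat)%:Z)%R|)%N.
    rewrite -Zp_int_eq0 // intrB intrM zE -[(c : nat)%:Z%:~R]/((c : nat)%:R : 'Z_q).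
    by rewrite natr_Zp subrr.
  move/(dvdn_trans kq) => H.
  rewrite -[(_ %| _)%N]/(k%:Z %| z)%Z -(subrK (k%:Z * (c : nat)%:Z) z).
  by rewrite rpredD // dvdz_mulr.
rewrite -[(_ %| _)%N]/(k%:Z %| z)%Z => /dvdzP[t ->].
by exists t%:~R => //; rewrite mulrC intrM.
Qed.

Lemma distinct_modP p q (A : {set 'Z_q}) : (1 < q)%N -> (p %| q)%N ->
  distinct_mod (principal_ideal p%:R) A ->
  {in A &, forall a b : 'Z_q, a != b -> ~~ (p %| `|((a : nat)%:Z - (b : nat)%:Z)%R|)%N}.
Proof.
move=> q1 pq dA a b aA bA /(dA a b aA bA).
rewrite -(mem_principal_ideal _ q1 pq) intrB.
by rewrite -[(a : nat)%:Z%:~R]/((a : nat)%:R : 'Z_q)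
  -[(b : nat)%:Z%:~R]/((b : nat)%:R : 'Z_q) !natr_Zp.
Qed.

Section Reduction.
Variables (p v w : nat).
Hypotheses (p_prime : prime p) (w_range : (1 <= w <= v)%N).

Let w_gt0 : (0 < w)%N. Proof. by case/andP: w_range. Qed.
Let v_gt0 : (0 < v)%N. Proof. by case/andP: w_range => /leq_trans H /H. Qed.
Let pv_gt1 : (1 < p ^ v)%N.
Proof. by rewrite -(exp1n v) ltn_exp2r // prime_gt1. Qed.
Let pw_dvd : (p ^ w %| p ^ v)%N.
Proof. by rewrite dvdn_exp2l //; case/andP: w_range. Qed.

Definition reduce_set (B : {set 'Z_(p ^ v)}) : {set 'Z_(p ^ w)} :=
  [set (b : nat)%:R | b : 'Z_(p ^ v) in B].

Lemma eq_reduce (b : 'Z_(p ^ v)) (y : int) :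
  ((b : nat)%:R == y%:~R :> 'Z_(p ^ w)) = (p ^ w %| `|(y - (b : nat)%:Z)%R|)%N.
Proof.
rewrite -Zp_int_eq0 ?intrB ?subr_eq0 1?eq_sym //.
by rewrite -(exp1n w) ltn_exp2r // prime_gt1.
Qed.

(** Gives the condition modulo the ideal the form that the separation by valuation requires:
    membership in a set of residues modulo [p ^ w]. *)
Lemma reduce_set_in_mod (B : {set 'Z_(p ^ v)}) (y : nat) :
  ((y%:Z)%:~R \in reduce_set B) = in_mod B (principal_ideal (p ^ w)%:R) y%:R.
Proof.
have E (b : 'Z_(p ^ v)) :
    (y%:R - b \in principal_ideal (p ^ w)%:R) = ((b : nat)%:R == (y%:Z)%:~R :> 'Z_(p ^ w)).
  rewrite eq_reduce -(mem_principal_ideal _ pv_gt1 pw_dvd) intrB.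
  by rewrite -[(b : nat)%:Z%:~R]/((b : nat)%:R : 'Z_(p ^ v)) natr_Zp.
apply/imsetP/existsP => -[b].
  by move=> bB yb; exists b; rewrite bB E yb eqxx.
by rewrite E => /andP[bB /eqP <-]; exists b.
Qed.

Variable B : {set 'Z_(p ^ v)}.
Hypothesis B_distinct : distinct_mod (principal_ideal p%:R) B.

Let B_neq (b c : 'Z_(p ^ v)) : b \in B -> c \in B -> b != c ->
  ~~ (p %| `|((b : nat)%:Z - (c : nat)%:Z)%R|)%N.
Proof.
move=> bB cB; apply: distinct_modP (B_distinct) _ _ bB cB => //.
exact: dvdn_exp.
Qed.

(** Residues with equal image modulo [p ^ w] are congruent modulo [p], hence equal if both lie in
    [B]. *)
Lemma card_reduce_set : #|reduce_set B| = #|B|.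
Proof.
apply: card_in_imset => b c bB cB E; apply/eqP; apply: contraT => /(B_neq bB cB).
apply: contraNT => _; rewrite distnC; apply: dvdn_trans (_ : p ^ w %| _)%N.
  exact: dvdn_exp.
by rewrite -eq_reduce; apply/eqP.
Qed.

Lemma reduce_set_distinct : {in reduce_set B &, forall b c : 'Z_(p ^ w),
  b != c -> ~~ (p %| `|((b : nat)%:Z - (c : nat)%:Z)%R|)%N}.
Proof.
move=> _ _ /imsetP[b bB ->] /imsetP[c cB ->] bc.
have bc' : b != c by apply: contraNneq bc => ->.
apply: contra (B_neq bB cB bc').
set b' : 'Z_(p ^ w) := (b : nat)%:R; set c' : 'Z_(p ^ w) := (c : nat)%:R => H.
(* A residue and the representative of its reduction differ by a multiple of [p ^ w], hence of
   [p]. *)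
have P (d : 'Z_(p ^ v)) (d' := (d : nat)%:R : 'Z_(p ^ w)) :
    (p%:Z %| (d : nat)%:Z - (d' : nat)%:Z)%Z.
  apply: dvdn_trans (dvdn_exp w_gt0 (dvdnn p)) _.
  by rewrite Zp_intB_eq0.
rewrite -[(_ %| _)%N]/(p%:Z %| (b : nat)%:Z - (c : nat)%:Z)%Z.
rewrite (_ : _ - _ = ((b : nat)%:Z - (b' : nat)%:Z) + ((b' : nat)%:Z - (c' : nat)%:Z)
  - ((c : nat)%:Z - (c' : nat)%:Z)); last by lia.
by rewrite rpredB ?P // rpredD ?P.
Qed.
End Reduction.

(** * Lifting polynomials and their values *)

Section Lift.
Variables (q n : nat).
Implicit Types (f : {mpoly 'Z_q[n]}) (x : 'I_n -> 'Z_q).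

(** A natural number representing the value of [f] at [x], built from canonical representatives. It
    links two moduli between which there need be no ring morphism. *)
Definition lift_eval f x : nat :=
  (\sum_(m <- msupp f) (f@_m : 'Z_q) * \prod_i x i ^ m i)%N.

Definition lift_mpoly (S : comNzRingType) f : {mpoly S[n]} :=
  \sum_(m <- msupp f) (f@_m : nat)%:R *: 'X_[m].

Lemma natr_lift_eval f x : (lift_eval f x)%:R = f.@[x].
Proof.
rewrite natr_sum mevalE; apply: eq_bigr => m _.
rewrite natrM natr_Zp natr_prod; congr (_ * _); apply: eq_bigr => i _.
by rewrite natrX natr_Zp.
Qed.

Lemma meval_lift_mpoly (S : comNzRingType) f x :
  (lift_mpoly S f).@[fun i => (x i : nat)%:R] = (lift_eval f x)%:R.
Proof.
rewrite raddf_sum natr_sum /=; apply: eq_bigr => m _.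
rewrite mevalZ mevalX natrM natr_prod; congr (_ * _); apply: eq_bigr => i _.
by rewrite natrX.
Qed.

Lemma msize_lift_mpoly (S : comNzRingType) f : (msize (lift_mpoly S f) <= msize f)%N.
Proof.
apply: leq_trans (msize_sum _ _ _) _; apply/bigmax_leqP_seq => m mf _.
by apply: leq_trans (msizeZ_le _ _) _; rewrite msizeX msize_mdeg_lt.
Qed.

(** The bound is not [msize f], because [f] may be zero while the constant [c] is not. *)
Lemma msize_lift_mpoly_subC (S : comNzRingType) f (c : S) :
  (msize (lift_mpoly S f - c%:MP) <= (mpoly_deg f).+1)%N.
Proof.
apply: leq_trans (msizeD_le _ _) _; rewrite geq_max msizeN msizeC.
rewrite (leq_trans (msize_lift_mpoly S f)) /=; last exact: leqSpred.
by case: (c != 0).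
Qed.
End Lift.

(** * Counting the points of [Z] *)

Lemma all2_nthP (S T : Type) (r : S -> T -> bool) s t x0 y0 : size s = size t ->
  reflect (forall i, (i < size t)%N -> r (nth x0 s i) (nth y0 t i)) (all2 r s t).
Proof.
elim: s t => [|x s IH] [|y t] //=; [by move=> _; apply: ReflectT | case=> st].
apply: (iffP andP) => [[xy /(IH _ st) H] [|i]|H]; rewrite ?ltnS => *.
- exact: xy.
- exact: H.
- by split; [exact: (H 0%N)|apply/(IH _ st) => i; exact: (H i.+1)].
Qed.

Theorem theorem1p4 (p n r v : nat) (w : 'I_r -> nat)
    (A : 'I_n -> {set 'Z_(p ^ v)}) (B : 'I_r -> {set 'Z_(p ^ v)})
    (f : 'I_r -> {mpoly 'Z_(p ^ v)[n]})
    (p_prime : prime p) (n_gt0 : (0 < n)%N) (r_gt0 : (0 < r)%N)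
    (v_gt0 : (0 < v)%N)
    (w_range : forall j, (1 <= w j <= v)%N)
    (A_neq0 : forall i, A i != set0)
    (B_neq0 : forall j, B j != set0)
    (A_distinct : forall i, distinct_mod (principal_ideal p%:R) (A i))
    (B_distinct : forall j, distinct_mod (principal_ideal p%:R) (B j)) :
  let Z := restricted_zeros w A B f in
  Z = set0 \/
  (min_prod (fun i => #|A i|)
     (\sum_i #|A i|%:Z
        - \sum_j ((p ^ w j)%N%:Z - #|B j|%:Z) * (mpoly_deg (f j))%:Z)
   <= #|Z|)%N.
Proof.
move=> Z; have [->|[x0 x0Z]] := set_0Vmem Z; [by left | right].
have w_gt0 j : (0 < w j)%N by case/andP: (w_range j).
have pk_gt1 k : (0 < k)%N -> (1 < p ^ k)%N.
  by move=> k0; rewrite -(exp1n k) ltn_exp2r // prime_gt1.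
pose e := (\sum_j cofactor_valuation p (w j))%N.
have Q_gt1 : (1 < p ^ e.+1)%N by apply: pk_gt1.
pose iota (a : 'Z_(p ^ v)) : 'Z_(p ^ e.+1) := (a : nat)%:R.
pose B' j := reduce_set (w j) (B j).
pose G : {mpoly 'Z_(p ^ e.+1)[n]} := \prod_j \prod_(c | c \notin B' j)
  (lift_mpoly 'Z_(p ^ e.+1) (f j) - ((c : nat)%:R)%:MP).
pose d := (\sum_j \sum_(c | c \notin B' j) mpoly_deg (f j))%N.
have G_deg : (msize G <= d.+1)%N.
  apply: msize_prod_le => j _; apply: msize_prod_le => c _.
  exact: msize_lift_mpoly_subC.
(* The complement of [B' j] has [p ^ w j - #|B j|] elements, so [d] is exactly the quantity
   subtracted in the statement. *)
have dE : d%:Z = \sum_j ((p ^ w j)%N%:Z - #|B j|%:Z) * (mpoly_deg (f j))%:Z.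
  rewrite -sum_intz; apply: eq_bigr => j _.
  have pw_gt1 := pk_gt1 _ (w_gt0 j).
  have : (#|B j| + #|~: B' j| = p ^ w j)%N.
    rewrite -(card_reduce_set p_prime (w_range j) (B_distinct j)).
    by rewrite cardsC card_ord Zp_cast.
  rewrite (eq_bigl (mem (~: B' j))) => [|c]; last by rewrite !inE.
  by rewrite sum_nat_const PoszM => cardB; congr (_ * _); lia.
have G_eval (x : 'I_n -> 'Z_(p ^ v)) : G.@[fun i => iota (x i)] =
    (\prod_j \prod_(c | c \notin B' j) ((lift_eval (f j) x)%:Z - (c : nat)%:Z))%:~R.
  rewrite rmorph_prod rmorph_prod; apply: eq_bigr => j _.
  rewrite !rmorph_prod; apply: eq_bigr => c _ /=.
  by rewrite mevalB mevalC meval_lift_mpoly intrB.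
have G_neq0 (x : 'I_n -> 'Z_(p ^ v)) : (G.@[fun i => iota (x i)] != 0) =
    [forall j, in_mod (B j) (principal_ideal (p ^ w j)%:R) (f j).@[x]].
  have cofactorP j := dvdn_prod_notin p_prime (w_gt0 j)
    (reduce_set_distinct p_prime (w_range j) (B_distinct j)) (lift_eval (f j) x)%:Z.
  rewrite G_eval Zp_int_eq0 // (big_morph _ abszM (erefl : `|1%Z|%N = 1%N)).
  rewrite dvdn_prod_pfactor // => [|j]; last by case: (cofactorP j).
  rewrite negb_exists; apply: eq_forallb => j; case: (cofactorP j) => _ ->.
  by rewrite negbK reduce_set_in_mod // natr_lift_eval.
pose As := [seq enum (A i) | i <- enum 'I_n].
have sAs : size As = n by rewrite size_map size_enum_ord.
have nthAs (i : 'I_n) : nth [::] As i = enum (A i).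
  by rewrite (nth_map i) ?size_enum_ord // nth_ord_enum.
pose F (x : seq 'Z_(p ^ v)) := G.@[fun i : 'I_n => iota (nth 0 x i)].
have F_red : reduced_poly iota As d F by apply: reduced_poly_meval.
have As_uniq : all (fun A => uniq_roots (map iota A)) As.
  apply/allP => _ /mapP[i _ ->].
  have := enum_uniq (A i); have : {subset enum (A i) <= A i}.
    by move=> a; rewrite mem_enum.
  elim: (enum (A i)) => //= a s IH sA /andP[a_s uniq_s].
  rewrite IH ?andbT // => [|b bs]; last by rewrite sA // inE bs orbT.
  apply/allP => _ /mapP[b bs ->]; rewrite /diff_roots mulrC eqxx /=.
  (* The difference of two distinct points of [A i] is prime to [p], hence a unit modulo
     [p ^ e.+1]. *)
  have -> : iota b - iota a = ((b : nat)%:Z - (a : nat)%:Z)%:~R by rewrite intrB.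
  rewrite Zp_int_unit // coprimeXl // prime_coprime //.
  apply: distinct_modP (A_distinct i) _ _ _ _ _; rewrite ?dvdn_exp ?pk_gt1 //.
  - by rewrite sA // inE bs orbT.
  - by rewrite sA // mem_head.
  - by apply: contraNneq a_s => <-.
pose to_fun (x : seq 'Z_(p ^ v)) := [ffun i : 'I_n => nth 0 x i].
have gridP x : size x = n -> (x \in grid As) = (to_fun x \in family A).
  move=> sx; rewrite mem_grid sx sAs eqxx /=.
  apply/(all2_nthP _ 0 [::])/familyP => [|H i|H i]; first by rewrite sx sAs.
    by have := H i; rewrite sAs ltn_ord nthAs mem_enum ffunE => ->.
  rewrite sAs => iN; have := H (Ordinal iN).
  by rewrite ffunE (nthAs (Ordinal iN)) mem_enum.
have F_Z x : size x = n -> (x \in grid As) && (F x != 0) = (to_fun x \in Z).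
  move=> sx; rewrite gridP // [RHS]inE G_neq0; congr (_ && _).
  apply: eq_forallb => j; congr in_mod.
  by apply: meval_eq => i; rewrite ffunE.
have F_nz : has (fun x => F x != 0) (grid As).
  have sx : size [seq x0 i | i <- enum 'I_n] = n by rewrite size_map size_enum_ord.
  have fx : to_fun [seq x0 i | i <- enum 'I_n] = x0.
    by apply/ffunP => i; rewrite ffunE (nth_map i) ?size_enum_ord // nth_ord_enum.
  by move: x0Z; rewrite -fx -F_Z // => /andP[xG Fx]; apply/hasP; eexists; first exact: xG.
have [ys [ysA sum_ys prod_ys]] := alon_furedi As_uniq F_red F_nz.
have sys : size ys = n by move: ysA; rewrite all2E sAs => /andP[/eqP].
have big_ys idx op : \big[op/idx]_(y <- ys) y = \big[op/idx]_(i < n) nth 0%N ys i.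
  by rewrite (big_nth 0%N) sys big_mkord.
(* The sum of [ys] is at least the prescribed [N], so its product dominates the minimum. *)
apply: leq_trans (_ : \prod_(i < n) nth 0%N ys i <= _)%N.
  apply: min_prod_le_prod => [i|].
    have := all2_nthP _ 0%N [::] (etrans sys (esym sAs)) ysA.
    by move/(_ i); rewrite sAs nthAs -cardE => ->.
  rewrite -dE lerBlDr !sum_intz -PoszD lez_nat; move: sum_ys.
  by rewrite !sumnE big_ys 2!big_map big_enum /=; under eq_bigr do rewrite -cardE.
rewrite -big_ys; apply: leq_trans prod_ys _.
rewrite -size_filter -(size_map to_fun) cardE.
have grid_size x : x \in grid As -> size x = n.
  by rewrite mem_grid sAs => /andP[/eqP].
(* Lists of length [n] with the same image under [to_fun] coincide, so the nonzeros of [F] on the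
   grid inject into [Z]. *)
apply: uniq_leq_size => [|y /mapP[x + ->]].
  rewrite map_inj_in_uniq ?filter_uniq // => [|x y].
    by apply: grid_uniq; apply/allP => _ /mapP[i _ ->]; exact: enum_uniq.
  rewrite !mem_filter => /andP[_ /grid_size sx] /andP[_ /grid_size sy] /ffunP E.
  apply: (@eq_from_nth _ 0) => [|i]; rewrite sx // => iN.
  by have := E (Ordinal iN); rewrite !ffunE.
by rewrite mem_filter mem_enum => /andP[Fx xG]; rewrite -F_Z ?grid_size ?xG.
Qed.
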